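(* Let $0<s\leq k\leq n$ be positive integers. Let $L=\{\ell_1,\ldots,\ell_s\}$ be a set of $s$ positive integers such that $0<\ell_1<\ldots<\ell_s$. Suppose that $n\geq \binom{k^2}{\ell_1+1}s+\ell_1$. Let $\mathcal{F}=\{F_1,\ldots,F_m\}$ be an $L$-intersecting, $k$-uniform family of $m$ subsets of $[n]$. Suppose that $\bigcap_{F\in\mathcal{F}}F=\emptyset$. Then $$ m\leq \binom{n-\ell_1}{s}. $$
   Context: $[n]=\{1,2,\ldots,n\}$. A family $\mathcal{F}$ is a set of (distinct) subsets of $[n]$, so $m=|\mathcal{F}|$. A family $\mathcal{F}$ is $k$-uniform if $|F|=k$ for each $F\in\mathcal{F}$. For a set $L$ of nonnegative integers, a family $\mathcal{F}$ is $L$-intersecting if $|E\cap F|\in L$ for every pair $E,F$ of distinct members of $\mathcal{F}$. *)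

(* Defs.v *)
From mathcomp Require Import all_boot.

Set Implicit Arguments.
Unset Strict Implicit.
Unset Printing Implicit Defensive.

Definition uniform_family (n k : nat) (F : {set {set 'I_n}}) : Prop :=
  forall A : {set 'I_n}, A \in F -> #|A| = k.

Definition intersecting_family (n : nat) (L : {pred nat})
    (F : {set {set 'I_n}}) : Prop :=
  forall A B : {set 'I_n},
    A \in F -> B \in F -> A != B -> #|A :&: B| \in L.

(* Main.v *)
Require Import Defs.
From mathcomp Require Import all_boot all_algebra.
From mathcomp Require Import zify ring.

(** Write l for the least element of L.  The bound comes from a small set that
    every member of F meets in at least l + 1 points.  Fix A in F.  As the
    members of F have no common point, each x in A is missed by some member
    R x of F.  Let G be the union of A and of all the R x: since each R x
    shares at least l >= 1 points with A, it has at most k - 1 points outside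
    A, so #|G| <= k + k (k - 1) = k ^ 2.  A member B meeting G in at most l
    points would meet A and every R x in the very same l points; such a point
    x lies in A, and hence in R x, which is absurd ([transversal_meets]).

    So F is covered by the stars {B in F | S \subset B}, for S ranging over the
    (l + 1)-subsets of G.  Two members of a star share at least l + 1 points, so
    only s - 1 intersection sizes survive; deleting S from all the members, the
    theorem of Ray-Chaudhuri and Wilson ([ray_chaudhuri_wilson]) bounds each
    star by 'C(n - l - 1, s - 1).  Hence
    #|F| <= 'C(k ^ 2, l + 1) 'C(n - l - 1, s - 1), and the lower bound on n
    makes this at most (n - l) / s * 'C(n - l - 1, s - 1) = 'C(n - l, s).

    The Ray-Chaudhuri-Wilson bound is proved by linear algebra over the
    rationals.  On k-element sets B, the indicators of J \subset B with
    #|J| = s span all the indicators of I \subset B with #|I| <= s, thus all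
    the functions of B which are polynomials of degree at most s in its
    characteristic vector.  Among these are the functions
    \prod_(l in L) (#|A :&: B| - l), for A in F.  As L contains the intersection
    sizes and only numbers less than k, each of them vanishes on F except at A:
    evaluated on F, they form an invertible diagonal matrix. *)

(** * The Ray-Chaudhuri-Wilson bound *)

Section RayChaudhuriWilson.

Import GRing.Theory Num.Theory.
Local Open Scope ring_scope.

Variables (T : finType) (D : {set T}) (k s : nat) (F : {set {set T}}).
Hypothesis F_sub : forall B, B \in F -> B \subset D.
Hypothesis F_unif : forall B, B \in F -> #|B| = k.
Hypothesis le_sk : (s <= k)%N.

Definition evalF (g : {set T} -> rat) : 'rV[rat]_#|F| :=
  \row_j g (enum_val j).

Lemma eq_evalF g h : {in F, g =1 h} -> evalF g = evalF h.
Proof. by move=> gh; apply/rowP=> j; rewrite !mxE gh ?enum_valP. Qed.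

Lemma evalF_sum (I : finType) (P : pred I) (g : I -> {set T} -> rat) :
  evalF (fun B => \sum_(i | P i) g i B) = \sum_(i | P i) evalF (g i).
Proof.
by apply/rowP=> j; rewrite mxE summxE; apply: eq_bigr => i _; rewrite mxE.
Qed.

Lemma evalF_scale a g : evalF (fun B => a * g B) = a *: evalF g.
Proof. by apply/rowP=> j; rewrite !mxE. Qed.

Definition ground_subsets := [set J : {set T} | J \subset D & #|J| == s].

Definition inclusion_mx : 'M[rat]_(#|ground_subsets|, #|F|) :=
  \matrix_(i < #|ground_subsets|, j < #|F|) (enum_val i \subset enum_val j)%:R.

Definition spanned (g : {set T} -> rat) : bool :=
  (evalF g <= inclusion_mx)%MS.

Definition intersection_poly (L : seq nat) (A B : {set T}) : rat :=
  \prod_(l <- L) (#|A :&: B|%:R - l%:R).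

Lemma sum_indicatorU1 (A I B : {set T}) :
  \sum_(a in A) ((a |: I \subset B)%:R : rat)
    = (I \subset B)%:R * #|A :&: B|%:R.
Proof.
rewrite -sum1_card natr_sum big_distrr /=.
under [RHS]eq_bigl => a do rewrite inE.
rewrite big_mkcondr /=.
apply: eq_bigr => a _; rewrite subUset sub1set.
by case: (a \in B); rewrite ?mulr1.
Qed.

(** By descending induction on #|I|: for #|I| < s and B in F, summing the
    indicator of x |: I \subset B over the points x of D outside I counts
    I \subset B exactly k - #|I| times, a nonzero number. *)
Lemma indicator_in_span (I : {set T}) :
  (#|I| <= s)%N ->
  spanned (fun B => (I \subset B)%:R).
Proof.
rewrite /spanned; move Em : (s - #|I|)%N => m.
elim: m => [|m IHm] in I Em * => le_Is.
  have cardI : #|I| == s by rewrite eqn_leq le_Is -subn_eq0 Em.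
  have [sID | nsID] := boolP (I \subset D).
    have gI : I \in ground_subsets by rewrite inE sID.
    suff ->: evalF (fun B => (I \subset B)%:R)
             = row (enum_rank_in gI I) inclusion_mx by apply: row_sub.
    by apply/rowP=> j; rewrite !mxE enum_rankK_in.
  suff ->: evalF (fun B => (I \subset B)%:R) = 0 by apply: sub0mx.
  apply/rowP=> j; have FB := enum_valP j; rewrite !mxE.
  case: (boolP (I \subset _)) => // sIB.
  by case/negP: nsID; apply: subset_trans sIB (F_sub _ FB).
have k_nz : ((k - #|I|)%:R : rat) != 0 by rewrite pnatr_eq0; lia.
have eq_sum : (k - #|I|)%:R *: evalF (fun B => (I \subset B)%:R)
    = \sum_(x in D :\: I) evalF (fun B => (x |: I \subset B)%:R).
  rewrite -evalF_scale -evalF_sum; apply: eq_evalF => B FB /=.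
  rewrite sum_indicatorU1.
  case: (boolP (I \subset B)) => [sIB|]; last by rewrite mulr0 mul0r.
  rewrite mulr1 mul1r setIC setIDA (setIidPl (F_sub _ FB)) cardsDS //.
  by rewrite (F_unif _ FB).
rewrite -(scalerK k_nz (evalF _)) eq_sum; apply/scalemx_sub/summx_sub => x.
rewrite inE => /andP[nIx _].
by apply: IHm; rewrite cardsU1 nIx; lia.
Qed.

(** Each linear factor #|A :&: B| - l raises the degree by one: multiplied
    by the indicator of I \subset B, it becomes a combination of this indicator
    and of the indicators of a |: I \subset B, for a in A. *)
Lemma intersection_poly_in_span (A : {set T}) (L : seq nat) (I : {set T}) :
  (#|I| + size L <= s)%N ->
  spanned (fun B => (I \subset B)%:R * intersection_poly L A B).
Proof.
elim: L I => [|l L IHL] I /= le_s.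
  rewrite addn0 in le_s.
  rewrite /spanned (eq_evalF _ (fun B => (I \subset B)%:R)).
    exact: indicator_in_span.
  by move=> B _; rewrite /intersection_poly big_nil mulr1.
pose g (J B : {set T}) := (J \subset B)%:R * intersection_poly L A B.
rewrite /spanned.
have ->: evalF (fun B => (I \subset B)%:R * intersection_poly (l :: L) A B)
    = \sum_(a in A) evalF (g (a |: I)) + (- l%:R) *: evalF (g I).
  rewrite -evalF_sum -evalF_scale; apply/rowP=> j; rewrite !mxE.
  rewrite {1}/intersection_poly big_cons -/(intersection_poly _ _ _).
  by rewrite /g -big_distrl /= sum_indicatorU1; ring.
apply: addmx_sub; last by apply/scalemx_sub/IHL; lia.
apply: summx_sub => a _; apply: IHL.
by rewrite cardsU1; lia.
Qed.

End RayChaudhuriWilson.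

Section RayChaudhuriWilsonBound.

Import GRing.Theory Num.Theory.
Local Open Scope ring_scope.

Lemma ray_chaudhuri_wilson (T : finType) (D : {set T}) (k : nat) (L : seq nat)
    (F : {set {set T}}) :
    (forall B, B \in F -> B \subset D) ->
    (forall B, B \in F -> #|B| = k) ->
    uniq L -> all (fun l => l < k)%N L ->
    (forall A B, A \in F -> B \in F -> A != B -> #|A :&: B| \in L) ->
  (#|F| <= 'C(#|D|, size L))%N.
Proof.
move=> F_sub F_unif L_uniq L_lt F_inter.
have le_Lk : (size L <= k)%N.
  rewrite -(size_iota 0 k); apply: uniq_leq_size => // l Ll.
  by rewrite mem_iota /= (allP L_lt).
pose p := intersection_poly T L.
pose M := \matrix_(i < #|F|, j < #|F|) p (enum_val i) (enum_val j).
have M_diag : M = diag_mx (\row_j p (enum_val j) (enum_val j)).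
  apply/matrixP=> i j; rewrite !mxE; case: eqVneq => [-> // | neq_ij].
  have neq : enum_val i != enum_val j by rewrite (inj_eq enum_val_inj).
  have Ll := F_inter _ _ (enum_valP i) (enum_valP j) neq.
  by rewrite /p /intersection_poly (big_rem _ Ll) /= subrr mul0r.
have M_unit : M \in unitmx.
  rewrite unitmxE unitfE M_diag det_diag; apply/prodf_neq0 => j _; rewrite mxE.
  rewrite /p /intersection_poly prodf_seq_neq0; apply/allP => l Ll /=.
  rewrite setIid (F_unif _ (enum_valP j)) subr_eq0 eqr_nat.
  by rewrite gtn_eqF ?(allP L_lt).
have sMW : (M <= inclusion_mx T D (size L) F)%MS.
  apply/row_subP => i.
  have ->: row i M = evalF T F (fun B => (set0 \subset B)%:R
      * intersection_poly T L (enum_val i) B).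
    by apply/rowP=> j; rewrite !mxE sub0set mul1r.
  by apply: (intersection_poly_in_span T D k); rewrite ?cards0.
rewrite -(mxrank_unit M_unit) -cards_draws.
exact: leq_trans (mxrankS sMW) (rank_leq_row _).
Qed.

End RayChaudhuriWilsonBound.

(** Members of F containing S are counted after deleting S from them, so that
    the Ray-Chaudhuri-Wilson bound applies to the complement of S. *)
Lemma star_bound (T : finType) (k : nat) (L : seq nat) (F : {set {set T}})
    (S : {set T}) :
    (forall B, B \in F -> #|B| = k) ->
    uniq L -> all (fun l => #|S| <= l < k) L ->
    (forall A B, A \in F -> B \in F -> A != B -> S \subset A -> S \subset B ->
       #|A :&: B| \in L) ->
  #|[set B in F | S \subset B]| <= 'C(#|T| - #|S|, size L).
Proof.
move=> F_unif L_uniq L_in F_inter.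
set E := [set B in F | S \subset B].
have E_F B : B \in E -> B \in F /\ S \subset B by rewrite inE => /andP[].
have inj : {in E &, injective (fun B => B :\: S)}.
  move=> A B /E_F[_ sSA] /E_F[_ sSB] /= eqD.
  by rewrite -(setID A S) -(setID B S) eqD (setIidPr sSA) (setIidPr sSB).
rewrite -(card_in_imset inj) -(cardsC S) addKn -(size_map (subn^~ #|S|) L).
apply: (@ray_chaudhuri_wilson _ _ (k - #|S|)).
- by move=> _ /imsetP[B _ ->]; rewrite setDE subsetIr.
- by move=> _ /imsetP[B /E_F[FB sSB] ->]; rewrite cardsDS // F_unif.
- rewrite map_inj_in_uniq // => x y /(allP L_in)/= x_in /(allP L_in)/= y_in.
  by lia.
- by apply/allP=> _ /mapP[x /(allP L_in)/= x_in ->]; lia.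
move=> _ _ /imsetP[A EA ->] /imsetP[B EB ->] neqD.
have [[FA sSA] [FB sSB]] := (E_F _ EA, E_F _ EB).
rewrite -setDIl cardsDS ?subsetI ?sSA //.
by apply/map_f/F_inter => //; apply: contraNneq neqD => ->.
Qed.

Lemma card_bigcup_le (I T : finType) (P : pred I) (E : I -> {set T}) :
  #|\bigcup_(i | P i) E i| <= \sum_(i | P i) #|E i|.
Proof.
elim/big_ind2: _ => [|A a B b le_a le_b|//]; first by rewrite cards0.
exact: leq_trans (leq_card_setU _ _) (leq_add le_a le_b).
Qed.

(** * A small set meeting every member in many points *)

Section Transversal.

Variables (T : finType) (k l : nat) (F : {set {set T}}).
Hypotheses (l_gt0 : 0 < l) (k_gt0 : 0 < k).
Hypothesis F_unif : forall B, B \in F -> #|B| = k.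
Hypothesis F_inter :
  forall A B, A \in F -> B \in F -> A != B -> l <= #|A :&: B|.

Variables (A : {set T}) (R : T -> {set T}).
Hypothesis FA : A \in F.
Hypothesis R_F : forall x, R x \in F.
Hypothesis R_miss : forall x, x \notin R x.

Definition transversal_set := A :|: \bigcup_(x in A) (R x :\: A).

Lemma neq_missing x (B : {set T}) : x \in B -> B != R x.
Proof. by move=> Bx; apply: contraNneq (R_miss x) => <-. Qed.

Lemma card_transversal_set : #|transversal_set| <= k ^ 2.
Proof.
have le_RA x : x \in A -> #|R x :\: A| <= k.-1.
  move=> Ax; rewrite cardsD F_unif // setIC.
  by have := F_inter _ _ FA (R_F x) (neq_missing _ _ Ax); lia.
have le_cup : #|\bigcup_(x in A) (R x :\: A)| <= k * k.-1.
  apply: leq_trans (card_bigcup_le _ _ _ _) _.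
  by rewrite -{1}(F_unif _ FA) -sum_nat_const; apply: leq_sum.
apply: leq_trans (leq_card_setU _ _) _.
by rewrite (F_unif _ FA); case: (k) le_cup => [|k']; nia.
Qed.

(** Suppose that B meets the set in at most l points.  Every C among A and the
    R x for x in A, if distinct from B, meets B in at least l points, all of
    them in the set, so B has the same trace on C as on the whole set.  For
    x in B :&: A this applies to both A and R x, so x would lie in R x. *)
Lemma transversal_meets B : B \in F -> l < #|B :&: transversal_set|.
Proof.
move=> FB; rewrite ltnNge; apply/negP => le_l.
have sub_eq C : C \in F -> B != C -> C \subset transversal_set ->
    B :&: C = B :&: transversal_set.
  move=> FC neqBC sCG; apply/eqP; rewrite eqEcard setIS //=.
  exact: leq_trans le_l (F_inter _ _ FB FC neqBC).
have sAG : A \subset transversal_set by apply: subsetUl.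
have sRG x : x \in A -> R x \subset transversal_set.
  move=> Ax; apply/subsetP=> y Ry; rewrite inE.
  have [//|nAy] := boolP (y \in A).
  by apply/bigcupP; exists x; rewrite // inE nAy.
have eqA : B :&: A = B :&: transversal_set.
  have [eqBA | /sub_eq-> //] := eqVneq B A.
  by rewrite eqBA setIid (setIidPl sAG).
have /card_gt0P[x] : 0 < #|B :&: A|.
  have [-> | /(F_inter _ _ FB FA)] := eqVneq B A; last exact: leq_trans.
  by rewrite setIid F_unif.
rewrite inE => /andP[Bx Ax]; have /negP[] := R_miss x.
have /setP/(_ x) := sub_eq _ (R_F x) (neq_missing _ _ Bx) (sRG _ Ax).
by rewrite -eqA !inE Bx Ax.
Qed.

End Transversal.

(** * The bound *)

Lemma card_star_cover (T : finType) (F : {set {set T}}) (G : {set T})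
    (t M : nat) :
    (forall B, B \in F -> t <= #|B :&: G|) ->
    (forall S : {set T}, #|S| = t -> #|[set B in F | S \subset B]| <= M) ->
  #|F| <= 'C(#|G|, t) * M.
Proof.
move=> G_meets star_le; rewrite -cards_draws -sum_nat_const.
set draws := [set S : {set T} | _ & _].
have sF : F \subset \bigcup_(S in draws) [set B in F | S \subset B].
  apply/subsetP=> B FB; have := G_meets _ FB.
  rewrite -bin_gt0 -cards_draws => /card_gt0P[S].
  rewrite inE subsetI => /andP[/andP[sSB sSG] cardS].
  by apply/bigcupP; exists S; rewrite inE ?FB ?sSG.
apply: leq_trans (subset_leq_card sF) _.
apply: leq_trans (card_bigcup_le _ _ _ _) _; apply: leq_sum => S.
by rewrite inE => /andP[_ /eqP]; apply: star_le.
Qed.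

(** Absorbs the loss of those sizes in L that are too large to occur: the
    bound on a star then has a smaller lower index. *)
Lemma leq_bin_half (N a b : nat) : a <= b -> b.*2 <= N -> 'C(N, a) <= 'C(N, b).
Proof.
elim: b => [|b IHb]; first by rewrite leqn0 => /eqP->.
rewrite leq_eqVlt => /predU1P[-> // | lt_ab] le_bN.
apply: leq_trans (IHb _ _) _; [by [] | lia |].
rewrite -(leq_pmul2l (ltn0Sn b)) mul_bin_left leq_mul2r.
by apply/orP; right; lia.
Qed.

(* MathComp world. [n] is 'I_n; the increasing tuple ell lists the s elements
   of L, so path ltn 0 ell says 0 < l_1 < ... < l_s. *)
Theorem proposition1p9 (n k s : nat) (ell : s.-tuple nat)
    (F : {set {set 'I_n}})
    (s_gt0 : 0 < s) (le_sk : s <= k) (le_kn : k <= n)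
    (ell_incr : path ltn 0 ell)
    (n_large : 'C(k ^ 2, (nth 0 ell 0).+1) * s + nth 0 ell 0 <= n)
    (F_inter : intersecting_family (fun l => l \in ell) F)
    (F_unif : uniform_family k F)
    (F_cap : \bigcap_(A in F) A = set0) :
  #|F| <= 'C(n - nth 0 ell 0, s).
Proof.
have [-> | /set0Pn[A FA]] := eqVneq F set0; first by rewrite cards0.
have k_gt0 := leq_trans s_gt0 le_sk.
case: s ell => [|r] [[|l t] //= size_t]
  in s_gt0 le_sk ell_incr n_large F_inter *.
have {F_inter} F_inter : intersecting_family (fun x => x \in l :: t) F.
  by move=> B C FB FC neqBC; apply: F_inter.
move: ell_incr => /andP[l_gt0 t_incr].
have lt_lt : all (ltn l) t by apply: order_path_min t_incr; apply: ltn_trans.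
have t_uniq : uniq t.
  exact: (sorted_uniq ltn_trans ltnn) (path_sorted t_incr).
have F_inter_ge B C : B \in F -> C \in F -> B != C -> l <= #|B :&: C|.
  move=> FB FC neqBC; have := F_inter _ _ FB FC neqBC.
  by rewrite inE => /predU1P[-> // | /(allP lt_lt)/ltnW].
have missing x : exists2 B : {set 'I_n}, B \in F & x \notin B.
  apply/exists_inP; apply: contraFT (in_set0 x).
  rewrite negb_exists_in -F_cap => /forall_inP R_none.
  by apply/bigcapP => B /R_none; rewrite negbK.
have [R R_F R_miss] := fin_all_exists2 missing.
pose G := transversal_set _ A R.
have cardG : #|G| <= k ^ 2 by apply: (card_transversal_set _ _ l F).
have G_meets B : B \in F -> l < #|B :&: G| by apply: (transversal_meets _ k).
have lt_lk : l < k.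
  rewrite -(F_unif _ FA).
  exact: leq_trans (G_meets _ FA) (subset_leq_card (subsetIl _ _)).
(* With the bound on n, this puts r in the lower half of n - l.+1. *)
have bin_ge2 : 1 < 'C(k ^ 2, l.+1).
  have: l.+1 < k ^ 2 by nia.
  case: (k ^ 2) => [//|m] lt_lm; rewrite binS.
  have: 0 < 'C(m, l) by rewrite bin_gt0; lia.
  have: 0 < 'C(m, l.+1) by rewrite bin_gt0; lia.
  lia.
(* Sizes at least k do not occur, and would put zeros on the diagonal or
   break the degree bound; hence the filter. *)
have star_le (S : {set 'I_n}) : #|S| = l.+1 ->
    #|[set B in F | S \subset B]| <= 'C(n - l.+1, r).
  move=> cardS; pose L := [seq x <- t | x < k].
  apply: (@leq_trans 'C(n - l.+1, size L)).
    rewrite -cardS -[X in X - _](card_ord n).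
    apply: (star_bound _ k) => //; first exact: filter_uniq.
      apply/allP=> x; rewrite mem_filter cardS andbC => /andP[xt ->].
      by rewrite andbT; apply: (allP lt_lt).
    move=> B C FB FC neqBC sSB sSC; rewrite mem_filter.
    apply/andP; split.
      rewrite -(F_unif _ FB) ltn_neqAle subset_leq_card ?subsetIl // andbT.
      apply: contraNneq neqBC => cardBC; rewrite eqEcard !F_unif // leqnn andbT.
      by apply/setIidPl/eqP; rewrite eqEcard subsetIl cardBC /=.
    have := F_inter _ _ FB FC neqBC; rewrite inE => /predU1P[eq_l | //].
    have: #|S| <= #|B :&: C| by rewrite subset_leq_card // subsetI sSB.
    by rewrite eq_l cardS ltnn.
  apply: leq_bin_half; last by nia.
  have <- : size t = r by move: size_t; rewrite eqSS => /eqP.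
  by rewrite size_filter count_size.
have le_F : #|F| <= 'C(k ^ 2, l.+1) * 'C(n - l.+1, r).
  apply: leq_trans (card_star_cover _ _ _ l.+1 _ G_meets star_le) _.
  by rewrite leq_mul2r leq_bin2l ?orbT.
rewrite -(leq_pmul2l (ltn0Sn r)) -mul_bin_diag -subnS.
apply: leq_trans (leq_mul (leqnn _) le_F) _.
rewrite mulnA leq_mul2r; apply/orP; right.
by rewrite mulnC leq_subRL; lia.
Qed.
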